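(* Let $\mathcal S=(\mathcal V,\mathcal C,\mathbb T,E)$ be a Monadic Equational System, with $T$ the endofunctor underlying $\mathbb T$, and let $u,v:C\to TA$ be morphisms of $\mathcal C$. If $E\vdash u\equiv v:C\to TA$ is derivable in the Equational Metalogic associated to $\mathcal S$, then every $\mathcal S$-algebra satisfies $u\equiv v:C\to TA$.
   Context: An object written in place of a morphism denotes its identity. **Actions.** Let $\mathcal V=(\mathcal V,I,\cdot,\alpha,\lambda,\rho)$ be a monoidal category. A $\mathcal V$-action is a category $\mathcal C$ with a functor $*:\mathcal V\times\mathcal C\to\mathcal C$ and natural isomorphisms $\underline\lambda_C:I*C\to C$, $\underline\alpha_{U,V,C}:(U\cdot V)*C\to U*(V*C)$ with $\underline\lambda_{V*C}\circ\underline\alpha_{I,V,C}=\lambda_V*C$, $(V*\underline\lambda_C)\circ\underline\alpha_{V,I,C}=\rho_V*C$ and $(U*\underline\alpha_{V,W,C})\circ\underline\alpha_{U,V\cdot W,C}\circ(\alpha_{U,V,W}*C)=\underline\alpha_{U,V,W*C}\circ\underline\alpha_{U\cdot V,W,C}$. It is biclosed if every functor $(-)*C:\mathcal V\to\mathcal C$ has a right adjoint $\underline{\mathcal C}(C,-)$, with counit $\underline\varepsilon^C_D:\underline{\mathcal C}(C,D)*C\to D$, and every functor $V*(-):\mathcal C\to\mathcal C$ has a right adjoint $[V,-]$. **Strong monads.** A strong monad $\mathbb T=(T,\varphi,\eta,\mu)$ on $\mathcal C$ is a monad $(T,\eta,\mu)$ on $\mathcal C$ with a natural transformation $\varphi_{V,C}:V*TC\to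 T(V*C)$ such that $T(\underline\lambda_C)\circ\varphi_{I,C}=\underline\lambda_{TC}$, $\varphi_{U,V*C}\circ(U*\varphi_{V,C})\circ\underline\alpha_{U,V,TC}=T(\underline\alpha_{U,V,C})\circ\varphi_{U\cdot V,C}$, $\varphi_{V,C}\circ(V*\eta_C)=\eta_{V*C}$ and $\varphi_{V,C}\circ(V*\mu_C)=\mu_{V*C}\circ T(\varphi_{V,C})\circ\varphi_{V,TC}$. **Satisfaction.** A $T$-equation $u\equiv v:C\to TA$ is a parallel pair of morphisms $u,v:C\to TA$ of $\mathcal C$. For a morphism $s:TX\to X$ and $t:C\to TA$ put $[\![t]\!]_{(X,s)}=s\circ T(\underline\varepsilon^A_X)\circ\varphi_{\underline{\mathcal C}(A,X),A}\circ(\underline{\mathcal C}(A,X)*t):\underline{\mathcal C}(A,X)*C\to X$. Then $(X,s)$ satisfies $u\equiv v:C\to TA$ iff $[\![u]\!]_{(X,s)}=[\![v]\!]_{(X,s)}$. **Monadic Equational Systems.** A Monadic Equational System (MES) $(\mathcal V,\mathcal C,\mathbb T,E)$ consists of a monoidal category $\mathcal V$, a biclosed $\mathcal V$-action $\mathcal C$, a strong monad $\mathbb T$ on $\mathcal C$, and a set $E$ of $T$-equations. An $\mathcal S$-algebra is an Eilenberg–Moore algebra $(X,s)$ for $\mathbb T$ satisfying every equation in $E$. **Equational Metalogic.** The derivable judgements $E\vdash u\equiv v:C\to TA$ (with $u,v:C\to TA$ in $\mathcal C$) are defined inductively by the rules: - Ref: $E\vdash u\equiv u:C\to TA$. - Sym: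 from $E\vdash u\equiv v:C\to TA$ infer $E\vdash v\equiv u:C\to TA$. - Trans: from $E\vdash u\equiv v:C\to TA$ and $E\vdash v\equiv w:C\to TA$ infer $E\vdash u\equiv w:C\to TA$. - Axiom: if $(u\equiv v:C\to TA)\in E$ infer $E\vdash u\equiv v:C\to TA$. - Comp: from $E\vdash u_1\equiv v_1:C\to TB$ and $E\vdash u_2\equiv v_2:B\to TA$ infer $E\vdash u_1\{u_2\}\equiv v_1\{v_2\}:C\to TA$, where $w_1\{w_2\}=\mu_A\circ T(w_2)\circ w_1$. - Ext: from $E\vdash u\equiv v:C\to TA$ infer, for any $V\in\mathcal V$, $E\vdash\langle V\rangle u\equiv\langle V\rangle v:V*C\to T(V*A)$, where $\langle V\rangle w=\varphi_{V,A}\circ(V*w)$. - Local: for any jointly epi family $\{e_i:C_i\to C\}_{i\in I}$ (that is, for all $f,g:C\to X$, if $f\circ e_i=g\circ e_i$ for all $i\in I$ then $f=g$), from $E\vdash u\circ e_i\equiv v\circ e_i:C_i\to TA$ for all $i\in I$ infer $E\vdash u\equiv v:C\to TA$. *)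

(* Defs.v *)
Set Implicit Arguments.
Unset Strict Implicit.
Unset Printing Implicit Defensive.

Declare Scope cat_scope.
Delimit Scope cat_scope with cat.
Local Open Scope cat_scope.

Record category := Category {
  Ob :> Type;
  Hom : Ob -> Ob -> Type;
  idm : forall X : Ob, Hom X X;
  comp : forall X Y Z : Ob, Hom Y Z -> Hom X Y -> Hom X Z;
  comp_idl : forall (X Y : Ob) (f : Hom X Y), comp (idm Y) f = f;
  comp_idr : forall (X Y : Ob) (f : Hom X Y), comp f (idm X) = f;
  comp_assoc : forall (X Y Z W : Ob) (h : Hom Z W) (g : Hom Y Z) (f : Hom X Y),
    comp h (comp g f) = comp (comp h g) f
}.

Arguments Hom {c} X Y.
Arguments idm {c} X.
Arguments comp {c X Y Z} g f.

Notation "g ∘ f" := (comp g f) (at level 40, left associativity) : cat_scope.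

Definition is_iso (C : category) (X Y : C) (f : Hom X Y) : Prop :=
  exists g : Hom Y X, g ∘ f = idm X /\ f ∘ g = idm Y.

Definition jointly_epi (C : category) (I : Type) (D : I -> C) (Y : C)
    (e : forall i, Hom (D i) Y) : Prop :=
  forall (X : C) (f g : Hom Y X), (forall i, f ∘ e i = g ∘ e i) -> f = g.

Record functor (C D : category) := Functor {
  fobj :> C -> D;
  fmap : forall X Y : C, Hom X Y -> Hom (fobj X) (fobj Y);
  fmap_id : forall X : C, fmap (idm X) = idm (fobj X);
  fmap_comp : forall (X Y Z : C) (g : Hom Y Z) (f : Hom X Y),
    fmap (g ∘ f) = fmap g ∘ fmap f
}.

Arguments fmap {C D} _ {X Y} _.

Definition id_functor (C : category) : functor C C.
Proof.
refine (@Functor C C (fun X => X) (fun X Y f => f) _ _); reflexivity.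
Defined.

Definition comp_functor (C D E : category) (G : functor D E) (F : functor C D) :
  functor C E.
Proof.
refine (@Functor C E (fun X => G (F X)) (fun X Y f => fmap G (fmap F f)) _ _).
- intros X; rewrite fmap_id; apply fmap_id.
- intros X Y Z g f; rewrite fmap_comp; apply fmap_comp.
Defined.

Record nat_trans (C D : category) (F G : functor C D) := NatTrans {
  component :> forall X : C, Hom (F X) (G X);
  naturality : forall (X Y : C) (f : Hom X Y),
    component Y ∘ fmap F f = fmap G f ∘ component X
}.

Record right_adjoint (C D : category) (F : functor C D) := RightAdjoint {
  radj :> functor D C;
  adj_unit : nat_trans (id_functor C) (comp_functor radj F);
  adj_counit : nat_trans (comp_functor F radj) (id_functor D);
  adj_triangle_l : forall X : C, adj_counit (F X) ∘ fmap F (adj_unit X) = idm (F X);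
  adj_triangle_r : forall Y : D,
    fmap radj (adj_counit Y) ∘ adj_unit (radj Y) = idm (radj Y)
}.

Definition prod_category (C D : category) : category.
Proof.
refine (@Category (C * D)
  (fun p q => (Hom (fst p) (fst q) * Hom (snd p) (snd q))%type)
  (fun p => (idm (fst p), idm (snd p)))
  (fun p q r g f => (fst g ∘ fst f, snd g ∘ snd f)) _ _ _).
- intros p q [f1 f2]; simpl; now rewrite !comp_idl.
- intros p q [f1 f2]; simpl; now rewrite !comp_idr.
- intros p q r s h g f; simpl; now rewrite !comp_assoc.
Defined.

Definition bimap (C D E : category) (F : functor (prod_category C D) E)
    (X X' : C) (Y Y' : D) (f : Hom X X') (g : Hom Y Y') :
    Hom (F (X, Y)) (F (X', Y')) :=
  @fmap _ _ F (X, Y) (X', Y') (f, g).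

Definition fix_left (C D E : category) (F : functor (prod_category C D) E) (X : C) :
  functor D E.
Proof.
refine (@Functor D E (fun Y => F (X, Y)) (fun Y Y' g => bimap F (idm X) g) _ _).
- intros Y; exact (fmap_id F (X, Y)).
- intros Y Y' Y'' h g; unfold bimap; rewrite <- fmap_comp; simpl.
  now rewrite comp_idl.
Defined.

Definition fix_right (C D E : category) (F : functor (prod_category C D) E) (Y : D) :
  functor C E.
Proof.
refine (@Functor C E (fun X => F (X, Y)) (fun X X' f => bimap F f (idm Y)) _ _).
- intros X; exact (fmap_id F (X, Y)).
- intros X X' X'' h f; unfold bimap; rewrite <- fmap_comp; simpl.
  now rewrite comp_idl.
Defined.

Record monoidal_category := MonoidalCategory {
  mcat :> category;
  munit : mcat;
  mtensor : functor (prod_category mcat mcat) mcat;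
  massoc : forall U V W : mcat,
    Hom (mtensor (mtensor (U, V), W)) (mtensor (U, mtensor (V, W)));
  mlunit : forall V : mcat, Hom (mtensor (munit, V)) V;
  mrunit : forall V : mcat, Hom (mtensor (V, munit)) V;
  massoc_natural : forall (U U' V V' W W' : mcat)
      (f : Hom U U') (g : Hom V V') (h : Hom W W'),
    massoc U' V' W' ∘ bimap mtensor (bimap mtensor f g) h
    = bimap mtensor f (bimap mtensor g h) ∘ massoc U V W;
  mlunit_natural : forall (V V' : mcat) (f : Hom V V'),
    mlunit V' ∘ bimap mtensor (idm munit) f = f ∘ mlunit V;
  mrunit_natural : forall (V V' : mcat) (f : Hom V V'),
    mrunit V' ∘ bimap mtensor f (idm munit) = f ∘ mrunit V;
  massoc_iso : forall U V W : mcat, is_iso (massoc U V W);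
  mlunit_iso : forall V : mcat, is_iso (mlunit V);
  mrunit_iso : forall V : mcat, is_iso (mrunit V);
  mpentagon : forall U V W X : mcat,
    bimap mtensor (idm U) (massoc V W X) ∘ massoc U (mtensor (V, W)) X
      ∘ bimap mtensor (massoc U V W) (idm X)
    = massoc U V (mtensor (W, X)) ∘ massoc (mtensor (U, V)) W X;
  mtriangle : forall U V : mcat,
    bimap mtensor (idm U) (mlunit V) ∘ massoc U munit V
    = bimap mtensor (mrunit U) (idm V)
}.

Record action (V : monoidal_category) := Action {
  acat :> category;
  act : functor (prod_category V acat) acat;
  alunit : forall X : acat, Hom (act (munit V, X)) X;
  aassoc : forall (U W : V) (X : acat),
    Hom (act (mtensor V (U, W), X)) (act (U, act (W, X)));
  alunit_natural : forall (X X' : acat) (f : Hom X X'),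
    alunit X' ∘ bimap act (idm (munit V)) f = f ∘ alunit X;
  aassoc_natural : forall (U U' W W' : V) (X X' : acat)
      (f : Hom U U') (g : Hom W W') (h : Hom X X'),
    aassoc U' W' X' ∘ bimap act (bimap (mtensor V) f g) h
    = bimap act f (bimap act g h) ∘ aassoc U W X;
  alunit_iso : forall X : acat, is_iso (alunit X);
  aassoc_iso : forall (U W : V) (X : acat), is_iso (aassoc U W X);
  alunit_aassoc : forall (W : V) (X : acat),
    alunit (act (W, X)) ∘ aassoc (munit V) W X = bimap act (mlunit W) (idm X);
  runit_aassoc : forall (W : V) (X : acat),
    bimap act (idm W) (alunit X) ∘ aassoc W (munit V) X
    = bimap act (mrunit W) (idm X);
  aassoc_pentagon : forall (U W Z : V) (X : acat),
    bimap act (idm U) (aassoc W Z X) ∘ aassoc U (mtensor V (W, Z)) X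
      ∘ bimap act (massoc U W Z) (idm X)
    = aassoc U W (act (Z, X)) ∘ aassoc (mtensor V (U, W)) Z X
}.

Notation "V ⊛ X" := (fobj (act _) (V, X)) (at level 35, right associativity) : cat_scope.
Notation "f ⊛' g" := (bimap (act _) f g) (at level 35, right associativity) : cat_scope.

(* [hom_adj B X] is the right adjoint C(X,-) of (-) ⊛ X, with values in V;
   [cotensor B W] is the right adjoint [W,-] of W ⊛ (-). *)
Record biclosed (V : monoidal_category) (C : action V) := Biclosed {
  hom_adj : forall X : C, right_adjoint (fix_right (act C) X);
  cotensor : forall W : V, right_adjoint (fix_left (act C) W)
}.

Record monad (C : category) := Monad {
  mfun :> functor C C;
  mret : nat_trans (id_functor C) mfun;
  mmul : nat_trans (comp_functor mfun mfun) mfun;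
  mmul_ret_l : forall X : C, mmul X ∘ mret (mfun X) = idm (mfun X);
  mmul_ret_r : forall X : C, mmul X ∘ fmap mfun (mret X) = idm (mfun X);
  mmul_assoc : forall X : C, mmul X ∘ mmul (mfun X) = mmul X ∘ fmap mfun (mmul X)
}.

Record strong_monad (V : monoidal_category) (C : action V) := StrongMonad {
  smonad :> monad C;
  strength : forall (W : V) (X : C), Hom (W ⊛ smonad X) (smonad (W ⊛ X));
  strength_natural : forall (W W' : V) (X X' : C) (f : Hom W W') (g : Hom X X'),
    strength W' X' ∘ (f ⊛' fmap smonad g) = fmap smonad (f ⊛' g) ∘ strength W X;
  strength_alunit : forall X : C,
    fmap smonad (alunit X) ∘ strength (munit V) X = alunit (smonad X);
  strength_aassoc : forall (U W : V) (X : C),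
    strength U (W ⊛ X) ∘ (idm U ⊛' strength W X) ∘ aassoc U W (smonad X)
    = fmap smonad (aassoc U W X) ∘ strength (mtensor V (U, W)) X;
  strength_ret : forall (W : V) (X : C),
    strength W X ∘ (idm W ⊛' mret smonad X) = mret smonad (W ⊛ X);
  strength_mul : forall (W : V) (X : C),
    strength W X ∘ (idm W ⊛' mmul smonad X)
    = mmul smonad (W ⊛ X) ∘ fmap smonad (strength W X) ∘ strength W (smonad X)
}.

Record em_algebra (C : category) (T : monad C) := EMAlgebra {
  carrier :> C;
  structure : Hom (T carrier) carrier;
  structure_ret : structure ∘ mret T carrier = idm carrier;
  structure_mul : structure ∘ mmul T carrier = structure ∘ fmap T structure
}.

(* [E X A u v] means that the T-equation u ≡ v : X → TA belongs to E. *)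
Definition equation_set (C : category) (T : functor C C) : Type :=
  forall X A : C, Hom X (T A) -> Hom X (T A) -> Prop.

Record MES := MonadicEquationalSystem {
  mes_base : monoidal_category;
  mes_cat : action mes_base;
  mes_biclosed : biclosed mes_cat;
  mes_monad : strong_monad mes_cat;
  mes_equations : equation_set mes_monad
}.

Definition hom_counit (V : monoidal_category) (C : action V) (B : biclosed C)
    (A X : C) : Hom (hom_adj B A X ⊛ A) X :=
  adj_counit (hom_adj B A) X.

Definition interp (V : monoidal_category) (C : action V) (B : biclosed C)
    (T : strong_monad C) (X : C) (s : Hom (T X) X) (Y A : C) (t : Hom Y (T A)) :
    Hom (hom_adj B A X ⊛ Y) X :=
  s ∘ fmap T (hom_counit B A X) ∘ strength T (hom_adj B A X) A
    ∘ (idm (hom_adj B A X) ⊛' t).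

Arguments interp {V C} B T {X} s {Y A} t.

Definition satisfies (V : monoidal_category) (C : action V) (B : biclosed C)
    (T : strong_monad C) (X : C) (s : Hom (T X) X) (Y A : C)
    (u v : Hom Y (T A)) : Prop :=
  interp B T s u = interp B T s v.

Arguments satisfies {V C} B T {X} s {Y A} u v.

Definition mes_satisfies (S : MES) (M : em_algebra (mes_monad S))
    (Y A : mes_cat S) (u v : Hom Y (mes_monad S A)) : Prop :=
  satisfies (mes_biclosed S) (mes_monad S) (structure M) u v.

Record S_algebra (S : MES) := SAlgebra {
  salg :> em_algebra (mes_monad S);
  salg_sat : forall (Y A : mes_cat S) (u v : Hom Y (mes_monad S A)),
    mes_equations u v -> mes_satisfies salg u v
}.

Definition kleisli_subst (C : category) (T : monad C) (X Y A : C)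
    (w1 : Hom X (T Y)) (w2 : Hom Y (T A)) : Hom X (T A) :=
  mmul T A ∘ fmap T w2 ∘ w1.

Arguments kleisli_subst {C} T {X Y A} w1 w2.

Definition strong_ext (V : monoidal_category) (C : action V) (T : strong_monad C)
    (W : V) (X A : C) (w : Hom X (T A)) : Hom (W ⊛ X) (T (W ⊛ A)) :=
  strength T W A ∘ (idm W ⊛' w).

Arguments strong_ext {V C} T W {X A} w.

Inductive derivable (S : MES) :
    forall Y A : mes_cat S, Hom Y (mes_monad S A) -> Hom Y (mes_monad S A) -> Prop :=
| EML_Ref : forall (Y A : mes_cat S) (u : Hom Y (mes_monad S A)),
    derivable u u
| EML_Sym : forall (Y A : mes_cat S) (u v : Hom Y (mes_monad S A)),
    derivable u v -> derivable v u
| EML_Trans : forall (Y A : mes_cat S) (u v w : Hom Y (mes_monad S A)),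
    derivable u v -> derivable v w -> derivable u w
| EML_Axiom : forall (Y A : mes_cat S) (u v : Hom Y (mes_monad S A)),
    mes_equations u v -> derivable u v
| EML_Comp : forall (Y Z A : mes_cat S)
      (u1 v1 : Hom Y (mes_monad S Z)) (u2 v2 : Hom Z (mes_monad S A)),
    derivable u1 v1 -> derivable u2 v2 ->
    derivable (kleisli_subst (mes_monad S) u1 u2) (kleisli_subst (mes_monad S) v1 v2)
| EML_Ext : forall (W : mes_base S) (Y A : mes_cat S) (u v : Hom Y (mes_monad S A)),
    derivable u v -> derivable (strong_ext (mes_monad S) W u) (strong_ext (mes_monad S) W v)
| EML_Local : forall (I : Type) (Y A : mes_cat S) (D : I -> mes_cat S)
      (e : forall i, Hom (D i) Y) (u v : Hom Y (mes_monad S A)),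
    jointly_epi e ->
    (forall i, derivable (u ∘ e i) (v ∘ e i)) ->
    derivable u v.

(* Main.v *)
Require Import Defs.

(** Replacing the counit [C(A,X) ⊛ A → X] in the interpretation of a term by an
    arbitrary [k : W ⊛ A → X] gives, by the universal property of [C(A,X)], an
    equivalent notion of satisfaction, now quantified over all [W] and [k]. In
    this form every rule is sound: substitution [w1{w2}] becomes evaluation of
    [w1] at the evaluation of [w2]; extension by [W] becomes evaluation at a
    tensor, up to the associator; and the local rule holds because [W ⊛ -], a
    left adjoint, preserves jointly epi families. *)

Set Implicit Arguments.
Unset Strict Implicit.
Unset Printing Implicit Defensive.

Local Open Scope cat_scope.

Lemma iso_epi (C : category) (X Y Z : C) (e : Hom X Y) (f g : Hom Y Z) :
  is_iso e -> f ∘ e = g ∘ e -> f = g.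
Proof.
intros [e' [_ He]] H.
rewrite <- (comp_idr f), <- (comp_idr g), <- He, !comp_assoc.
now rewrite H.
Qed.

Lemma bimap_id (C D E : category) (F : functor (prod_category C D) E)
    (X : C) (Y : D) :
  bimap F (idm X) (idm Y) = idm (F (X, Y)).
Proof. exact (fmap_id F (X, Y)). Qed.

Lemma bimap_comp (C D E : category) (F : functor (prod_category C D) E)
    (X X' X'' : C) (Y Y' Y'' : D) (f' : Hom X' X'') (f : Hom X X')
    (g' : Hom Y' Y'') (g : Hom Y Y') :
  bimap F f' g' ∘ bimap F f g = bimap F (f' ∘ f) (g' ∘ g).
Proof.
symmetry.
exact (@fmap_comp _ _ F (X, Y) (X', Y') (X'', Y'') (f', g') (f, g)).
Qed.

Lemma right_adjoint_transpose (C D : category) (F : functor C D)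
    (G : right_adjoint F) (X : C) (Y : D) (k : Hom (F X) Y) :
  adj_counit G Y ∘ fmap F (fmap G k ∘ adj_unit G X) = k.
Proof.
rewrite fmap_comp, comp_assoc.
pose proof (naturality (adj_counit G) k) as H; simpl in H.
transitivity (k ∘ adj_counit G (F X) ∘ fmap F (adj_unit G X)).
- now f_equal.
- rewrite <- comp_assoc, adj_triangle_l; apply comp_idr.
Qed.

(** Maps out of [F Y] correspond to their transposes out of [Y]. By naturality of the unit,
    agreement on every [fmap F (e i)] becomes agreement of the transposes on every [e i]. *)
Lemma left_adjoint_jointly_epi (C D : category) (F : functor C D)
    (G : right_adjoint F) (I : Type) (Z : I -> C) (Y : C)
    (e : forall i, Hom (Z i) Y) :
  jointly_epi e -> jointly_epi (fun i => fmap F (e i)).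
Proof.
intros He X f g H.
rewrite <- (right_adjoint_transpose G f), <- (right_adjoint_transpose G g).
do 2 f_equal.
apply He; intro i.
pose proof (naturality (adj_unit G) (e i)) as N; simpl in N.
rewrite <- !comp_assoc.
transitivity (fmap G f ∘ (fmap G (fmap F (e i)) ∘ adj_unit G (Z i))).
- now f_equal.
- rewrite comp_assoc, <- fmap_comp, H, fmap_comp, <- comp_assoc.
  now f_equal.
Qed.

Section Evaluation.

Variables (V : monoidal_category) (C : action V) (T : strong_monad C).

Definition eval_at (X : C) (s : Hom (T X) X) (W : V) (A : C)
    (k : Hom (W ⊛ A) X) (Y : C) (t : Hom Y (T A)) : Hom (W ⊛ Y) X :=
  s ∘ fmap T k ∘ strength T W A ∘ (idm W ⊛' t).

(** Naturality of the strength in its [V]-argument; this reduces evaluation at any [k] to evaluation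
    at the counit. *)
Lemma eval_at_precomp (X : C) (s : Hom (T X) X) (W W' : V) (A : C)
    (f : Hom W' W) (k : Hom (W ⊛ A) X) (Y : C) (t : Hom Y (T A)) :
  eval_at s (k ∘ (f ⊛' idm A)) t = eval_at s k t ∘ (f ⊛' idm Y).
Proof.
unfold eval_at.
pose proof (strength_natural T f (idm A)) as N; rewrite fmap_id in N.
rewrite fmap_comp, <- !comp_assoc, bimap_comp.
rewrite (comp_assoc (fmap T (f ⊛' idm A))), <- N, <- comp_assoc, bimap_comp.
now rewrite !comp_idl, !comp_idr.
Qed.

Lemma satisfies_eval_at (B : biclosed C) (X : C) (s : Hom (T X) X) (Y A : C)
    (u v : Hom Y (T A)) :
  satisfies B T s u v <->
  forall (W : V) (k : Hom (W ⊛ A) X), eval_at s k u = eval_at s k v.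
Proof.
split; intro H.
- intros W k.
  (* [k] factors as the counit after its transpose tensored with [A]. *)
  pose proof (right_adjoint_transpose (hom_adj B A) k) as E.
  change (hom_counit B A X
    ∘ ((fmap (hom_adj B A) k ∘ adj_unit (hom_adj B A) W) ⊛' idm A) = k) in E.
  rewrite <- E.
  etransitivity; [apply eval_at_precomp|].
  etransitivity; [|symmetry; apply eval_at_precomp].
  now apply (f_equal (fun h => h ∘ _)).
(* [interp] is definitionally [eval_at] at the counit. *)
- apply H.
Qed.

Lemma eval_at_comp (X : C) (s : Hom (T X) X) (W : V) (A : C)
    (k : Hom (W ⊛ A) X) (Y Z : C) (t : Hom Y (T A)) (e : Hom Z Y) :
  eval_at s k (t ∘ e) = eval_at s k t ∘ (idm W ⊛' e).
Proof.
unfold eval_at.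
now rewrite <- !comp_assoc, bimap_comp, comp_idl.
Qed.

Lemma eval_at_kleisli_subst (M : em_algebra T) (W : V) (A : C)
    (k : Hom (W ⊛ A) M) (Y Z : C) (w1 : Hom Y (T Z)) (w2 : Hom Z (T A)) :
  eval_at (structure M) k (kleisli_subst T w1 w2)
  = eval_at (structure M) (eval_at (structure M) k w2) w1.
Proof.
unfold kleisli_subst.
rewrite eval_at_comp; unfold eval_at at 2; f_equal.
rewrite eval_at_comp; unfold eval_at.
set (s := structure M).
rewrite !fmap_comp.
pose proof (strength_mul T W A) as Hm.
pose proof (strength_natural T (idm W) w2) as Hn.
(* The multiplication law of the algebra, followed by naturality of [mmul] at [k]. *)
assert (Hs : s ∘ fmap T s ∘ fmap T (fmap T k)
  = s ∘ fmap T k ∘ mmul T (W ⊛ A)).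
{ transitivity (s ∘ mmul T M ∘ fmap T (fmap T k)).
  - apply (f_equal (fun h => h ∘ _)); symmetry; apply structure_mul.
  - rewrite <- !comp_assoc; apply f_equal, (naturality (mmul T) k). }
rewrite !comp_assoc, Hs.
rewrite <- !comp_assoc.
do 2 apply f_equal.
rewrite <- Hn, (comp_assoc (strength T W A)), Hm, <- !comp_assoc.
reflexivity.
Qed.

(** Naturality of the associator moves it past [w], and [strength_aassoc] merges the two strengths
    into one. *)
Lemma eval_at_strong_ext (X : C) (s : Hom (T X) X) (U W : V) (A : C)
    (k : Hom (U ⊛ W ⊛ A) X) (Y : C) (w : Hom Y (T A)) :
  eval_at s k (strong_ext T W w) ∘ aassoc U W Y
  = eval_at s (k ∘ aassoc U W A) w.
Proof.
unfold strong_ext.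
rewrite eval_at_comp; unfold eval_at.
pose proof (aassoc_natural (idm U) (idm W) w) as N; rewrite bimap_id in N.
rewrite fmap_comp, <- !comp_assoc, <- N.
rewrite (comp_assoc (idm U ⊛' strength T W A)).
rewrite (comp_assoc (strength T U (W ⊛ A))).
rewrite (comp_assoc (strength T U (W ⊛ A)) (idm U ⊛' strength T W A)).
rewrite strength_aassoc.
now rewrite <- !comp_assoc.
Qed.

End Evaluation.

Theorem theorem7p2 (S : MES) (C A : mes_cat S) (u v : Hom C (mes_monad S A)) :
  derivable u v -> forall M : S_algebra S, mes_satisfies M u v.
Proof.
(* Passing to [eval_at] before the induction makes the hypotheses hold for all [W] and [k]. *)
intros D M; apply satisfies_eval_at.
induction D as [ | Y A u v _ IH | Y A u v w _ IH1 _ IH2 | Y A u v HE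
  | Y Z A u1 v1 u2 v2 _ IH1 _ IH2 | W Y A u v _ IH | I Y A D e u v He _ IH ];
  intros U k.
- reflexivity.
- now rewrite IH.
- now rewrite IH1, IH2.
- revert U k; apply (satisfies_eval_at (mes_biclosed S)).
  exact (salg_sat M HE).
(* After [IH2], [IH1] is used with the evaluation of [v2] as its [k]. *)
- now rewrite !eval_at_kleisli_subst, IH2, IH1.
(* Precomposing with the invertible associator reduces the goal to [IH] at the tensor of [U] and
   [W]. *)
- apply (iso_epi (aassoc_iso U W Y)).
  now rewrite !eval_at_strong_ext, IH.
- apply (left_adjoint_jointly_epi (cotensor (mes_biclosed S) U) He).
  intro i.
  change (eval_at (structure M) k u ∘ (idm U ⊛' e i)
    = eval_at (structure M) k v ∘ (idm U ⊛' e i)).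
  now rewrite <- !eval_at_comp, IH.
Qed.
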